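(* Let $x_0\in\mathrm{dom}\,\psi$, $v_0=x_0$, and let the sequences $\{x_t\}_{t\ge0}$, $\{v_t\}_{t\ge0}$ be generated by the Primal Reduced-Gradient Method: for each $t\ge0$, a) $x_{t+1}\in\mathrm{dom}\,\psi$ together with $V_\psi(x_{t+1})=V(x_{t+1})+\psi'_{x_{t+1}}$, $\psi'_{x_{t+1}}\in\partial\psi(x_{t+1})$, satisfies $$\langle V_\psi(x_{t+1}),v_t-x_{t+1}\rangle>0\ge\langle V_\psi(x_{t+1}),x^*-x_{t+1}\rangle\quad\forall x^*\in X^*;$$ b) $a_{t+1}=\langle V_\psi(x_{t+1}),v_t-x_{t+1}\rangle/\|V_\psi(x_{t+1})\|_*^2$ and $v_{t+1}=\arg\min_{x\in\mathrm{dom}\,\psi}\{a_{t+1}\langle V_\psi(x_{t+1}),x-v_t\rangle+\beta(v_t,x)\}$. Let $V_i(x)=\langle V_\psi(x_i),x_i-x\rangle$, $b_i=\frac{\langle V_\psi(x_i),v_{i-1}-x_i\rangle^2}{2\|V_\psi(x_i)\|_*^2}$ for $i\ge1$, and $B_t=\sum_{i=1}^tb_i$ ($B_0=0$). Then for any $t\ge0$ and $x\in\mathrm{dom}\,\psi$, $$\sum_{i=1}^ta_iV_i(x)+B_t+\beta(v_t,x)\le\beta(x_0,x).$$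
   Context: $\mathbb{E}$ is a finite-dimensional real vector space with dual $\mathbb{E}^*$, equipped with an arbitrary norm $\|\cdot\|$; $\|g\|_*=\max\{\langle g,x\rangle:\|x\|\le1\}$. $\psi$ is a proper closed convex function on $\mathbb{E}$ and $V:\mathrm{dom}\,\psi\to\mathbb{E}^*$ is a monotone operator: $\langle V(x)-V(y),x-y\rangle\ge0$ for $x,y\in\mathrm{dom}\,\psi$. $X^*$ is the set of points $x^*\in\mathrm{dom}\,\psi$ with $\langle V(x),x-x^*\rangle+\psi(x)\ge\psi(x^* )$ for all $x\in\mathrm{dom}\,\psi$. $d$ is a differentiable convex prox-function (with $\mathrm{dom}\,\psi\subseteq\mathrm{dom}\,d\subseteq\mathbb{E}$) which is strongly convex with parameter one: $d(y)\ge d(x)+\langle\nabla d(x),y-x\rangle+\frac12\|y-x\|^2$ for $x,y\in\mathrm{dom}\,d$. The Bregman distance is $\beta(x,y)=d(y)-d(x)-\langle\nabla d(x),y-x\rangle$. The minimizers defining $v_{t+1}$ are assumed to exist. *)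

(* Defs.v *)
From HB Require Import structures.
From mathcomp Require Import all_boot all_order all_algebra.
From mathcomp Require Import all_classical all_reals all_analysis.

Set Implicit Arguments.
Unset Strict Implicit.
Unset Printing Implicit Defensive.

Import Order.TTheory GRing.Theory Num.Theory.
Import numFieldNormedType.Exports.

Local Open Scope classical_set_scope.
Local Open Scope ring_scope.

#[short(type="finNormedModType")]
HB.structure Definition FinNormedModule (R : numFieldType) :=
  {E of Vector R E & NormedModule R E}.

Section Convex.
Context {R : realType} {E : finNormedModType R}.
Implicit Types (f : E -> \bar R) (x y : E) (g : 'Hom(E, R^o)).

(* The maximum in the definition of the dual norm is attained, the unit ball
   being compact; it is thus the supremum. *)
Definition dual_norm g : R := sup [set g x | x in [set x : E | `|x| <= 1]].

Definition edom f : set E := [set x | (f x < +oo)%E].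

Definition epigraph f : set (E * R^o)%type :=
  [set p | (f p.1 <= (p.2 : R)%:E)%E].

Definition proper_efun f := edom f !=set0 /\ forall x, (-oo < f x)%E.

Definition convex_efun f := convex_set (epigraph f).

Definition closed_efun f := closed (epigraph f).

Definition subdifferential f x : set 'Hom(E, R^o) :=
  [set g | forall y, (f x + (g (y - x))%:E <= f y)%E].

Definition monotone_on (D : set E) (V : E -> 'Hom(E, R^o)) :=
  forall x y, D x -> D y -> 0 <= (V x - V y) (x - y).

Definition weak_solutions (V : E -> 'Hom(E, R^o)) f : set E :=
  [set xs | edom f xs /\
    forall x, edom f x -> (f xs <= (V x (x - xs))%:E + f x)%E].

(* Frechet derivative at x relative to dom f: the usual one when x is interior
   to dom f, but also meaningful at boundary points and on domains with empty
   interior, where g need not be unique. *)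
Definition is_gradient f x g :=
  (fun y => (fine (f y) - fine (f x) - g (y - x)) / `|y - x|)
    @ within (edom f) x^' --> (0 : R).

Definition bregman f (df : E -> 'Hom(E, R^o)) x y : R :=
  fine (f y) - fine (f x) - df x (y - x).

(* A differentiable convex prox-function d, with gradient dd, strongly convex
   with parameter one. *)
Definition prox_function (d : E -> \bar R) (dd : E -> 'Hom(E, R^o)) :=
  [/\ proper_efun d, convex_efun d,
      forall x, edom d x -> is_gradient d x (dd x) &
      forall x y, edom d x -> edom d y ->
        fine (d y) >= fine (d x) + dd x (y - x) + 2^-1 * `|y - x| ^+ 2].

Definition is_argmin (D : set E) (F : E -> R) z :=
  D z /\ forall x, D x -> F z <= F x.

End Convex.

Section Method.
Context {R : realType} {E : finNormedModType R}.
Variables (psi : E -> \bar R) (V : E -> 'Hom(E, R^o)).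
Variables (d : E -> \bar R) (dd : E -> 'Hom(E, R^o)).
(* sg i is the chosen subgradient of psi at x i; sg 0 is never used. *)
Variables (x v : nat -> E) (sg : nat -> 'Hom(E, R^o)).

Definition Vpsi i : 'Hom(E, R^o) := V (x i) + sg i.

(* The next three are only meaningful for i >= 1. *)
Definition coef_a i : R := Vpsi i (v i.-1 - x i) / dual_norm (Vpsi i) ^+ 2.

Definition coef_b i : R :=
  (Vpsi i (v i.-1 - x i)) ^+ 2 / (2 * dual_norm (Vpsi i) ^+ 2).

Definition Vlin i (y : E) : R := Vpsi i (x i - y).

Definition sum_B t : R := \sum_(1 <= i < t.+1) coef_b i.

Definition reduced_gradient_method :=
  [/\ edom psi (x 0%N), v 0%N = x 0%N &
      forall t,
      [/\ edom psi (x t.+1),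
          subdifferential psi (x t.+1) (sg t.+1),
          0 < Vpsi t.+1 (v t - x t.+1),
          forall xs, weak_solutions V psi xs ->
            Vpsi t.+1 (xs - x t.+1) <= 0 &
          is_argmin (edom psi)
            (fun y => coef_a t.+1 * Vpsi t.+1 (y - v t) + bregman d dd (v t) y)
            (v t.+1)]].

End Method.

(* Main.v *)
(* The variational inequality of the minimization defining v_{t+1}, tested at y,
   bounds a <g, v_{t+1} - y> by a difference of Bregman distances minus
   beta(v_t, v_{t+1}).  With N the dual norm of g, strong convexity bounds
   a <g, v_t - v_{t+1}> - beta(v_t, v_{t+1}) by (a N)^2 / 2 = b_{t+1}, whereas
   a <g, v_t - x_{t+1}> = (a N)^2 = 2 b_{t+1}; the surplus b_{t+1} is what B_t
   accumulates. *)
Require Import Defs.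
From HB Require Import structures.
From mathcomp Require Import all_boot all_order all_algebra.
From mathcomp Require Import all_classical all_reals all_analysis.
From mathcomp Require Import ring lra.

Set Implicit Arguments.
Unset Strict Implicit.
Unset Printing Implicit Defensive.

Import Order.TTheory GRing.Theory Num.Theory.
Import numFieldNormedType.Exports.

Local Open Scope classical_set_scope.
Local Open Scope ring_scope.

Section Duality.
Context {R : realType} {E : finNormedModType R}.
Implicit Types (f : E -> \bar R) (g : 'Hom(E, R^o)).

(* In coordinates, the norm of E is continuous and does not vanish on the
   compact unit sphere of the sup norm. *)
Lemma coord_norm_bound (n : nat) (b : n.-tuple E) : basis_of fullv b ->
  exists2 m : R, 0 < m & forall (z : E) i, m * `|coord b i z| <= `|z|.
Proof.
move=> bb.
pose c z : 'rV[R]_n := \row_i coord b i z.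
pose L (u : 'rV[R]_n) : E := \sum_(i < n) u ord0 i *: b`_i.
have Lc z k : L (k *: c z) = k *: z.
  rewrite [in RHS](coord_basis bb (memvf z)) scaler_sumr.
  by apply: eq_bigr => i _; rewrite !mxE scalerA.
have coord_le z i : `|coord b i z| <= `|c z|.
  rewrite [leRHS]/Num.Def.normr /= mx_normrE; apply/bigmax_geP; right => /=.
  by exists (ord0, i); rewrite //= mxE.
have contNL : continuous (fun u => `|L u| : R).
  move=> u; apply: (@continuous_comp _ _ _ L (fun z => `|z|)).
    have := @continuous_big E 'I_n +%R 0 xpredT add_continuous
      'rV[R]_n (index_enum 'I_n) (fun i u => u ord0 i *: b`_i).
    apply=> i _ w.
    apply: (@continuous_comp _ _ _ (fun w : 'rV[R]_n => w ord0 i)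
      (fun k : R => k *: b`_i)).
      exact: coord_continuous.
    exact: scalel_continuous.
  exact: norm_continuous.
pose S := [set u : 'rV[R]_n | `|u| = 1].
have inS z : z != 0 -> S (`|c z|^-1 *: c z).
  move=> z0; apply: normfZV; apply: contra_neq z0 => cz0.
  by rewrite -[z]scale1r -Lc cz0 /L big1// => i _; rewrite !mxE mulr0 scale0r.
have [[u0 Su0]|S0] := pselect (S !=set0); last first.
  (* An empty sphere forces every [z] to be 0, and then any positive constant works. *)
  exists 1 => // z i; have [->|z0] := eqVneq z 0.
    by rewrite linear0 !normr0 mulr0.
  by case: S0; eexists; exact: inS z0.
have compS : compact S.
  apply: bounded_closed_compact.
    exists 1; split=> // M M1 u /= ->; exact: ltW.
  apply: (@preimage_closed _ _ (fun u : 'rV[R]_n => `|u|) [set r | r = 1]).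
    by move=> u _; exact: norm_continuous.
  exact: closed_eq.
have [v] := EVT_min_rV (ex_intro _ u0 Su0) compS (continuous_subspaceT contNL).
rewrite inE => Sv minv.
(* The constant is the minimum of the norm over the unit sphere in coordinates; it is positive
   because a basis is free. *)
exists `|L v|.
  rewrite normr_gt0; apply/eqP => Lv0.
  have v0 : v = 0.
    by apply/rowP => i; rewrite (freeP (basis_free bb) _ Lv0) mxE.
  by move: Sv; rewrite /S /= v0 normr0 => /esym/eqP; rewrite oner_eq0.
move=> z i; have [->|z0] := eqVneq z 0.
  by rewrite linear0 !normr0 mulr0.
have Sz := inS z z0.
have cz0 : 0 < `|c z|.
  rewrite lt_neqAle normr_ge0 andbT; apply/eqP => cz0; move: Sz.
  by rewrite /S /= -cz0 invr0 scale0r normr0 => /esym/eqP; rewrite oner_eq0.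
apply: (@le_trans _ _ (`|L v| * `|c z|)); first by rewrite ler_wpM2l.
rewrite -ler_pdivlMr// mulrC.
have := minv _ (mem_set Sz).
by rewrite Lc normrZ normfV normr_id.
Qed.

(** Expand [z] in a basis and bound each coordinate by [coord_norm_bound]. This makes the set in
    [dual_norm] bounded above, so that its [sup] is a true supremum and not a default value. *)
Lemma functional_bounded g : exists2 C : R, 0 <= C & forall z, `|g z| <= C * `|z|.
Proof.
have bb := vbasisP (fullv : {vspace E}).
have [m m0 mle] := coord_norm_bound bb.
exists (\sum_(i < \dim (fullv : {vspace E})) m^-1 * `|g (vbasis fullv)`_i|).
  by apply: sumr_ge0 => i _; rewrite mulr_ge0// invr_ge0 ltW.
move=> z; rewrite [in leLHS](coord_basis bb (memvf z)) linear_sum mulr_suml.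
apply: (le_trans (ler_norm_sum _ _ _)); apply: ler_sum => i _.
rewrite linearZ /= normrM mulrAC ler_wpM2r// mulrC ler_pdivlMr// mulrC.
exact: mle.
Qed.

Lemma le_dual_norm g z : g z <= dual_norm g * `|z|.
Proof.
have [->|z0] := eqVneq z 0; first by rewrite linear0 normr0 mulr0.
have nz0 : 0 < `|z| by rewrite normr_gt0.
have [C C0 gC] := functional_bounded g.
rewrite -ler_pdivrMr// mulrC.
suff : g (`|z|^-1 *: z) <= dual_norm g by rewrite linearZ.
apply: ub_le_sup; last first.
  by exists (`|z|^-1 *: z) => //=; rewrite normfZV.
exists C => _ [w /= w1 <-]; apply: (le_trans (ler_norm _)).
by rewrite (le_trans (gC w))// -[leRHS]mulr1 ler_wpM2l.
Qed.

(** With condition a) of the method, this makes the divisions in [coef_a] and [coef_b] genuine. *)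
Lemma dual_norm_gt0 g z : 0 < g z -> 0 < dual_norm g.
Proof.
move=> gz; have := lt_le_trans gz (le_dual_norm g z).
by rewrite pmulr_lgt0// normr_gt0; apply: contraTneq gz => ->; rewrite linear0 ltxx.
Qed.

Lemma edom_segment f y z (s : R) : (forall x, (-oo < f x)%E) ->
  convex_efun f -> edom f y -> edom f z -> 0 <= s <= 1 ->
  edom f (y + s *: (z - y)).
Proof.
move=> f_gt cf fy fz /andP[s0 s1].
have epi x : edom f x -> epigraph f (x, fine (f x)).
  by move=> fx; rewrite /epigraph /= fineK// fin_real// f_gt.
have := cf _ _ (Itv01 s0 s1) (mem_set (epi _ fz)) (mem_set (epi _ fy)).
rewrite inE /epigraph/= => le_f.
have -> : y + s *: (z - y) = s *: z + (1 - s) *: y.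
  by rewrite scalerBr scalerBl scale1r addrCA.
exact: le_lt_trans le_f (ltry _).
Qed.

(** The upper half of the first-order error estimate, cleared of its denominator so that it also
    covers [y = w], which the punctured limit leaves out. *)
Lemma gradient_bound f w g : is_gradient f w g -> forall e : R, 0 < e ->
  exists2 r : R, 0 < r & forall y, edom f y -> `|y - w| < r ->
    fine (f y) - fine (f w) <= g (y - w) + e * `|y - w|.
Proof.
move=> fwg e e0; have /cvgrPdist_le/(_ e e0) := fwg.
rewrite /nbhs /= /within /= => /nbhs_ballP[r /= r0 Br].
exists r => // y fy yr.
have [->|yw] := eqVneq y w; first by rewrite !subrr linear0 normr0 mulr0 addr0.
have nyw : 0 < `|y - w| by rewrite normr_gt0 subr_eq0.
have := Br y; rewrite -ball_normE /= distrC => /(_ yr yw fy).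
rewrite sub0r normrN normrM normfV normr_id ler_pdivrMr// => h.
by rewrite -lerBlDl (le_trans (ler_norm _)).
Qed.

(** First-order optimality at [w]: compare [w] with a point a fraction [s] of the way to [y],
    replace the increment of [d] by its linear part up to an error [s * e], divide by [s], and let
    [e] be arbitrary. *)
Lemma argmin_variational (D : set E) (d : E -> \bar R) dd g v w y (a : R) :
  (forall s : R, 0 <= s <= 1 -> D (w + s *: (y - w))) ->
  D `<=` edom d -> is_gradient d w (dd w) ->
  is_argmin D (fun z => a * g (z - v) + bregman d dd v z) w ->
  0 <= a * g (y - w) + dd w (y - w) - dd v (y - w).
Proof.
move=> segD Dd dw [Dw minw]; set z := y - w.
apply/ler_addgt0Pr => e e0.
have z1 : 0 < `|z| + 1 by rewrite ltr_pwDr.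
have [r r0 dr] := gradient_bound dw (divr_gt0 e0 z1).
(* The bound 1 keeps the point on the segment, the other one puts it within [r] of [w]; the added 1
   avoids a zero denominator when [y = w]. *)
pose s := Num.min 1 (r / (`|z| + 1)).
have s0 : 0 < s by rewrite lt_min ltr01 divr_gt0.
have s01 : 0 <= s <= 1 by rewrite ltW//= ge_min lexx.
have sz : w + s *: z - w = s *: z by rewrite addrC addKr.
have nsz : `|s *: z| = s * `|z| by rewrite normrZ gtr0_norm.
have := dr _ (Dd _ (segD s s01)); rewrite sz nsz.
have lt_r : s * `|z| < r.
  apply: (@lt_le_trans _ _ (s * (`|z| + 1))).
    by rewrite ltr_pM2l// ltrDl.
  by rewrite -ler_pdivlMr// ge_min lexx orbT.
move=> /(_ lt_r).
have := minw _ (segD s s01); rewrite /bregman -/z.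
have linE (h : 'Hom(E, R^o)) u : h (w + s *: z - u) = h (w - u) + s * h z.
  by rewrite addrAC linearD linearZ.
have ddwE : dd w (s *: z) = s * dd w z by rewrite linearZ.
rewrite !linE ddwE => h1 h2.
have h3 : e / (`|z| + 1) * (s * `|z|) <= s * e.
  by rewrite mulrCA ler_pM2l// mulrAC ler_pdivrMr// ler_pM2l// lerDl.
suff : 0 <= s * (a * g z + dd w z - dd v z + e) by rewrite pmulr_rge0.
lra.
Qed.

End Duality.

Theorem theorem1 (R : realType) (E : finNormedModType R)
    (psi : E -> \bar R) (V : E -> 'Hom(E, R^o))
    (d : E -> \bar R) (dd : E -> 'Hom(E, R^o))
    (x v : nat -> E) (sg : nat -> 'Hom(E, R^o))
    (psi_proper : proper_efun psi)
    (psi_closed : closed_efun psi)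
    (psi_convex : convex_efun psi)
    (V_monotone : monotone_on (edom psi) V)
    (d_prox : prox_function d dd)
    (dom_psi_d : edom psi `<=` edom d)
    (method : reduced_gradient_method psi V d dd x v sg)
    (t : nat) (y : E) (dom_y : edom psi y) :
  \sum_(1 <= i < t.+1) coef_a V x v sg i * Vlin V x sg i y
    + sum_B V x v sg t + bregman d dd (v t) y
  <= bregman d dd (x 0%N) y.
Proof.
have [_ psi_gt] := psi_proper.
have [_ _ d_grad d_strong] := d_prox.
have [dom_x0 v0E step] := method.
have dom_v k : edom psi (v k).
  by case: k => [|k]; [rewrite v0E|have [_ _ _ _ []] := step k].
elim: t => [|t IH].
  by rewrite /sum_B !big_geq// !add0r v0E.
(* It remains to show that the terms of index [t.+1] are paid for by the decrease of the Bregman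
   distance to [y]. *)
apply: le_trans IH.
have [_ _ + _ minv] := step t.
rewrite /sum_B !(big_nat_recr t.+1)//=.
move: minv; rewrite [coef_b _ _ _ _ t.+1]/coef_b [coef_a _ _ _ _ t.+1]/coef_a.
rewrite [Vlin _ _ _ t.+1 _]/Vlin /=.
set g := Vpsi V x sg t.+1; set N := dual_norm g; set p : R := g (v t - x t.+1).
set w := v t.+1 => minv p0.
have N0 : 0 < N := dual_norm_gt0 p0.
have := argmin_variational
  (fun s => edom_segment psi_gt psi_convex (dom_v t.+1) dom_y) dom_psi_d
  (d_grad _ (dom_psi_d _ (dom_v t.+1))) minv.
set a : R := p / N ^+ 2.
have := d_strong _ _ (dom_psi_d _ (dom_v t)) (dom_psi_d _ (dom_v t.+1)).
have := le_dual_norm g (v t - w); rewrite -/w -/N distrC.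
have a0 : 0 <= a by rewrite /a divr_ge0 ?sqr_ge0// ltW.
have bE : p ^+ 2 / (2 * N ^+ 2) = 2^-1 * (a * N) ^+ 2.
  by rewrite /a; field; rewrite gt_eqF.
have linE (h : 'Hom(E, R^o)) z z' : h (z - z') = h z - h z' :> R.
  exact: linearB.
have apE : a * (g (v t) - g (x t.+1)) = (a * N) ^+ 2.
  by rewrite -linE -/p /a; field; rewrite gt_eqF.
rewrite bE /bregman !linE.
set nv := `|_|; set A := \sum_(_ <= _ < _) _; set B := \sum_(_ <= _ < _) _.
move=> h1 h2 h3.
have h4 := ler_wpM2l a0 h1.
(* Young's inequality for [a * N * nv]: strong convexity absorbs half of [nv ^+ 2], and half of
   [(a * N) ^+ 2] is [coef_b] at [t.+1]. *)
have h5 := sqr_ge0 (a * N - nv).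
lra.
Qed.
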